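(* Let $\mathbf m=(m_1,\dots,m_n)$ be positive integers. Let $V(\mathbf m)$ be the set of integer vectors $\langle x_{1_1},\dots,x_{1_{m_1}},\dots,x_{n_1},\dots,x_{n_{m_n}}\rangle$ such that for all $i,j$, $0=x_{i_1}\le x_{i_j}\le x_{i_{j+1}}\le\sum_{k=i+1}^n m_k$, ordered by the reflexive-transitive closure of: $v\lessdot v'$ iff $v,v'$ differ in exactly one entry, which is one larger in $v'$. Then the rank-generating function of $V(\mathbf m)$, and also that of $\mathbf{BL}(\mathbf m)$, is \[\prod_{i=1}^{n}\begin{bmatrix}(\sum_{j=i}^n m_j)-1\\ m_i-1\end{bmatrix}_q,\qquad\text{where }\begin{bmatrix}a\\ b\end{bmatrix}_q=\frac{[a]_q!}{[a-b]_q!\,[b]_q!}.\]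
   Context: $\mathbf{BL}(\mathbf m)$ is the set of words of the multiset with $m_i$ copies of $i$ ($i\in[n]$) in which, for each $i\in[n-1]$, the first occurrence of $i$ precedes the first occurrence of $i+1$, partially ordered by the reflexive-transitive closure of: $s\lessdot t$ iff $t$ arises from $s$ by swapping two adjacent entries $a<b$ appearing as $ab$ in $s$. It is graded with minimum $1^{m_1}2^{m_2}\cdots n^{m_n}$; the rank of $s$ equals its number of inversions (pairs of positions $p<p'$ with $s_p>s_{p'}$). The rank of $v\in V(\mathbf m)$ is the sum of its entries. The rank-generating function of a graded poset $P$ is $\sum_{x\in P}q^{\mathrm{rk}(x)}$. Here $[a]_q!=\prod_{k=1}^a(1+q+\dots+q^{k-1})$. *)

(* Defs.v *)
From HB Require Import structures.
From mathcomp Require Import all_boot all_order all_fingroup all_algebra.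
From mathcomp Require Import fraction.
From mathcomp Require Import zify.

Set Implicit Arguments.
Unset Strict Implicit.
Unset Printing Implicit Defensive.

Import Order.TTheory GRing.Theory.

Definition covers (d : Order.disp_t) (P : finPOrderType d) (x y : P) : bool :=
  (x < y)%O && [forall z : P, ~~ ((x < z)%O && (z < y)%O)].

(* A finite poset is graded by [rk] when [rk] is its rank function: 0 on the
   minimal elements and increasing by exactly 1 along covers.  These two
   conditions determine [rk]. *)
HB.mixin Record FinPOrder_isGraded (d : Order.disp_t) P
    of Order.FinPOrder d P := {
  rk : P -> nat;
  rk_minimal : forall x : P, (forall y : P, ~~ (y < x)%O) -> rk x = 0;
  rk_cover : forall x y : P, covers x y -> rk y = (rk x).+1
}.

#[short(type="gradedFinPOrderType")]
HB.structure Definition GradedFinPOrder (d : Order.disp_t) :=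
  { P of Order.FinPOrder d P & FinPOrder_isGraded d P }.

Definition rank_gf (d : Order.disp_t) (P : gradedFinPOrderType d) : {poly int} :=
  (\sum_(x : P) 'X^(rk x))%R.

Definition qint (k : nat) : {poly int} := (\sum_(0 <= i < k) 'X^i)%R.

Definition qfact (a : nat) : {poly int} := (\prod_(1 <= k < a.+1) qint k)%R.

(* The quotient is taken literally, in the field of fractions of Z[q]. *)
Definition qbinom (a b : nat) : {fraction {poly int}} :=
  (tofrac (qfact a) / (tofrac (qfact (a - b)) * tofrac (qfact b)))%R.

Lemma connect_step (T : finType) (e : rel T) (x y : T) :
  connect e x y -> x = y \/ exists2 z, e x z & connect e z y.
Proof.
case/connectP => -[|z p] /= ep ->; first by left.
by case/andP: ep => xz zp; right; exists z => //; apply/connectP; exists p.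
Qed.

Lemma connect_rank (T : finType) (e : rel T) (r : T -> nat) (x y : T) :
  (forall x y, e x y -> r y = (r x).+1) ->
  connect e x y -> x = y \/ r x < r y.
Proof.
move=> er /connectP[p]; elim: p x => [|z p IH] x /= ep yE; first by left.
case/andP: ep => /er xz zp; right.
by have [<-|] := IH z zp yE; lia.
Qed.

Lemma connect_rank_anti (T : finType) (e : rel T) (r : T -> nat) :
  (forall x y, e x y -> r y = (r x).+1) -> antisymmetric (connect e).
Proof.
move=> er x y /andP[/(connect_rank er) xy /(connect_rank er) yx].
by case: xy => // xy; case: yx => // yx; lia.
Qed.

Lemma covers_step (d : Order.disp_t) (P : finPOrderType d) (e : rel P)
    (r : P -> nat) :
  (forall x y, e x y -> r y = (r x).+1) ->
  (forall x y, (x <= y)%O = connect e x y) ->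
  forall x y, covers x y -> e x y.
Proof.
move=> er le_e x y /andP[xy /forallP nz].
have /connect_step[xEy|[z xz zy]] : connect e x y by rewrite -le_e ltW.
  by rewrite xEy ltxx in xy.
have {}xz' : (x < z)%O.
  rewrite lt_neqAle le_e connect1 // andbT; apply/eqP => xEz.
  by have := er _ _ xz; rewrite xEz; lia.
move: zy; rewrite -le_e le_eqVlt => /orP[/eqP <- //|zy].
by have := nz z; rewrite xz' zy.
Qed.

Lemma step_lt (d : Order.disp_t) (P : finPOrderType d) (e : rel P)
    (r : P -> nat) :
  (forall x y, e x y -> r y = (r x).+1) ->
  (forall x y, (x <= y)%O = connect e x y) ->
  forall x y, e x y -> (x < y)%O.
Proof.
move=> er le_e x y xy; rewrite lt_neqAle le_e connect1 // andbT.
by apply/eqP => xEy; have := er _ _ xy; rewrite xEy; lia.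
Qed.

Definition slot (n : nat) (m : 'I_n -> nat) (i : 'I_n) (j : 'I_(m i)) :
  {i : 'I_n & 'I_(m i)} := Tagged (fun i => 'I_(m i)) j.

(* The entry x_{i_j} sits at index [slot j] with [j : 'I_(m i)], both
   indices counted from 0.  The defining inequalities bound every entry by 0
   and \sum_k m k, so storing entries in 'I_(\sum_k m k).+1 loses nothing and
   makes the type finite. *)
Definition in_V (n : nat) (m : 'I_n -> nat)
    (x : {ffun {i : 'I_n & 'I_(m i)} -> 'I_(\sum_(k < n) m k).+1}) : bool :=
  [forall i : 'I_n, forall j : 'I_(m i),
     ((j == 0 :> nat) ==> (x (slot j) == 0 :> nat)) &&
     [forall j' : 'I_(m i), (j' == j.+1 :> nat) ==>
        (x (slot j) <= x (slot j') <= \sum_(k < n | i < k) m k)]].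

Arguments in_V {n} m x.

Record V (n : nat) (m : 'I_n -> nat) : predArgType := MkV {
  entries : {ffun {i : 'I_n & 'I_(m i)} -> 'I_(\sum_(k < n) m k).+1};
  entriesP : in_V m entries
}.

HB.instance Definition _ (n : nat) (m : 'I_n -> nat) :=
  [isSub for @entries n m].
HB.instance Definition _ (n : nat) (m : 'I_n -> nat) :=
  [Finite of V m by <:].

Definition step_V (n : nat) (m : 'I_n -> nat) : rel (V m) := fun v w =>
  [exists p, (entries w p == (entries v p).+1 :> nat) &&
     [forall p', (p' != p) ==> (entries w p' == entries v p')]].

Definition entry_sum (n : nat) (m : 'I_n -> nat) (v : V m) : nat :=
  \sum_p entries v p.

Lemma step_V_sum (n : nat) (m : 'I_n -> nat) (v w : V m) :
  step_V v w -> entry_sum w = (entry_sum v).+1.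
Proof.
case/existsP => p /andP[/eqP wp /forallP wE].
rewrite /entry_sum (bigD1 p) //= wp [in RHS](bigD1 p) //= addSn.
congr (_ + _).+1; apply: eq_bigr => p' p'p.
by have /implyP/(_ p'p)/eqP -> := wE p'.
Qed.

Fact V_display : Order.disp_t. Proof. exact: Order.Disp tt tt. Qed.

HB.instance Definition _ (n : nat) (m : 'I_n -> nat) :=
  Order.Le_isPOrder.Build V_display (V m)
    (@connect0 _ (@step_V n m)) (connect_rank_anti (@step_V_sum n m))
    (@connect_trans _ (@step_V n m)).

Lemma le_V (n : nat) (m : 'I_n -> nat) (v w : V m) :
  (v <= w)%O = connect (@step_V n m) v w.
Proof. by []. Qed.

Lemma step_V_pred (n : nat) (m : 'I_n -> nat) (v : V m) :
  entry_sum v != 0 -> exists w, step_V w v.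
Proof.
rewrite /entry_sum sum_nat_eq0 negb_forall => /existsP[[i j0]] /= vj0.
pose pos (j : 'I_(m i)) := entries v (slot j) != 0 :> nat.
have posj0 : pos j0 by [].
case: (arg_minnP (fun j : 'I_(m i) => val j) posj0) => j posj jmin.
pose p := slot j.
pose w := [ffun q => if q == p then inord (entries v q).-1 else entries v q].
have wp : (w p).+1 = entries v p :> nat.
  rewrite ffunE eqxx inordK; first by move: posj; rewrite /pos -/p; lia.
  by have := ltn_ord (entries v p); lia.
have wE q : q != p -> w q = entries v q by move=> qp; rewrite ffunE (negbTE qp).
have w_le q : w q <= entries v q.
  by have [->|/wE ->] := eqVneq q p; lia.
have w_in : in_V m w.
  apply/forallP => k; apply/forallP => l.
  have /forallP/(_ k)/forallP/(_ l)/andP[v0 /forallP vle] := entriesP v.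
  apply/andP; split.
    apply/implyP => l0; have := w_le (slot l).
    by have /eqP -> := implyP v0 l0; rewrite leqn0.
  apply/forallP => l'; apply/implyP => ll'.
  have /andP[vll' vb] := implyP (vle l') ll'.
  apply/andP; split; last exact: leq_trans (w_le _) vb.
  have [l'p|/wE ->] := eqVneq (slot l') p;
    last exact: leq_trans (w_le _) vll'.
  have ki : k = i by case/(congr1 tag): l'p.
  subst k; move/eqP: l'p; rewrite eq_Tagged /= => /eqP l'j; subst l'.
  have [v0l|vl] := eqVneq (entries v (slot l) : nat) 0.
    by have := w_le (slot l); rewrite v0l leqn0 => /eqP ->.
  by have := jmin l vl; move: ll' => /eqP /=; lia.
exists (MkV w_in); apply/existsP; exists p => /=; rewrite wp eqxx /=.
by apply/forallP => q; apply/implyP => /wE ->.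
Qed.

Lemma entry_sum_minimal (n : nat) (m : 'I_n -> nat) (v : V m) :
  (forall w : V m, ~~ (w < v)%O) -> entry_sum v = 0.
Proof.
move=> vmin; apply/eqP/negPn/negP => /step_V_pred[w wv].
by have := vmin w; rewrite (step_lt (@step_V_sum n m) (@le_V n m) wv).
Qed.

Lemma entry_sum_cover (n : nat) (m : 'I_n -> nat) (v w : V m) :
  covers v w -> entry_sum w = (entry_sum v).+1.
Proof.
by move=> /(covers_step (@step_V_sum n m) (@le_V n m)); apply: step_V_sum.
Qed.

HB.instance Definition _ (n : nat) (m : 'I_n -> nat) :=
  FinPOrder_isGraded.Build V_display (V m)
    (@entry_sum_minimal n m) (@entry_sum_cover n m).

(* Letters are counted from 0, and [index i s] is the position of the first
   occurrence of [i] in [s]. *)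
Definition in_BL (n : nat) (m : 'I_n -> nat)
    (s : (\sum_(k < n) m k).-tuple 'I_n) : bool :=
  [forall i : 'I_n, count_mem i s == m i] &&
  [forall i : 'I_n, forall j : 'I_n,
     (j == i.+1 :> nat) ==> (index i s < index j s)].

Arguments in_BL {n} m s.

Record BL (n : nat) (m : 'I_n -> nat) : predArgType := MkBL {
  word : (\sum_(k < n) m k).-tuple 'I_n;
  wordP : in_BL m word
}.

HB.instance Definition _ (n : nat) (m : 'I_n -> nat) :=
  [isSub for @word n m].
HB.instance Definition _ (n : nat) (m : 'I_n -> nat) :=
  [Finite of BL m by <:].

Definition step_BL (n : nat) (m : 'I_n -> nat) : rel (BL m) := fun s t =>
  [exists p : 'I_(\sum_(k < n) m k), exists p' : 'I_(\sum_(k < n) m k),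
     [&& p' == p.+1 :> nat, tnth (word s) p < tnth (word s) p' &
         word t == [tuple tnth (word s) (tperm p p' k) | k < _]]].

Definition inv_set (N n : nat) (s : N.-tuple 'I_n) : {set 'I_N * 'I_N} :=
  [set pp : 'I_N * 'I_N |
     (pp.1 < pp.2) && (tnth s pp.2 < tnth s pp.1)].

Definition inversions (n : nat) (m : 'I_n -> nat) (s : BL m) : nat :=
  #|inv_set (word s)|.

Lemma inv_set_swap (N n : nat) (s : N.-tuple 'I_n) (k k' : 'I_N) :
  k' = k.+1 :> nat -> tnth s k < tnth s k' ->
  #|inv_set [tuple tnth s (tperm k k' p) | p < N]| = #|inv_set s|.+1.
Proof.
move=> kk' sk; set t := [tuple _ | p < N].
pose f (pp : 'I_N * 'I_N) := (tperm k k' pp.1, tperm k k' pp.2).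
have f_inj : injective f.
  by move=> [a b] [a' b'] [/perm_inj -> /perm_inj ->].
have kNk' : k != k' by apply/eqP => /(congr1 val) /=; lia.
suff -> : inv_set t = (k, k') |: f @^-1: inv_set s.
  rewrite cardsU1 card_preimset // !inE /= tpermL tpermR ltnNge.
  by rewrite kk' leqnSn /=.
apply/setP => -[p p']; rewrite !inE /= !tnth_mktuple xpair_eqE.
case: tpermP => [->|->|/eqP pk /eqP pk'];
  case: tpermP => [->|->|/eqP p'k /eqP p'k']; rewrite ?eqxx ?(negbTE kNk') //=;
  rewrite 1?[k' == k]eq_sym ?(negbTE kNk') ?(negbTE pk) ?(negbTE p'k') ?(negbTE pk') ?(negbTE p'k) ?andbF ?andbT /=;
  move: kNk'; do ?[move: pk pk' | move: p'k p'k']; rewrite -?val_eqE /=; lia.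
Qed.

Lemma step_BL_inversions (n : nat) (m : 'I_n -> nat) (s t : BL m) :
  step_BL s t -> inversions t = (inversions s).+1.
Proof.
case/existsP => p /existsP[p' /and3P[/eqP pp' sp /eqP tE]].
by rewrite /inversions tE; apply: inv_set_swap.
Qed.

Fact BL_display : Order.disp_t. Proof. exact: Order.Disp tt tt. Qed.

HB.instance Definition _ (n : nat) (m : 'I_n -> nat) :=
  Order.Le_isPOrder.Build BL_display (BL m)
    (@connect0 _ (@step_BL n m)) (connect_rank_anti (@step_BL_inversions n m))
    (@connect_trans _ (@step_BL n m)).

Lemma le_BL (n : nat) (m : 'I_n -> nat) (s t : BL m) :
  (s <= t)%O = connect (@step_BL n m) s t.
Proof. by []. Qed.

Lemma index_ltP (N n : nat) (s : N.-tuple 'I_n) (i j : 'I_n) :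
  reflect (exists2 p : 'I_N, tnth s p = i &
             forall p' : 'I_N, p' <= p -> tnth s p' != j)
          (index i s < index j s).
Proof.
have nf (k : 'I_n) (p : 'I_N) : tnth s p = k -> index k s <= p.
  rewrite leqNgt (tnth_nth k) => pk; apply/negP => /(before_find k) /=.
  by rewrite pk eqxx.
apply: (iffP idP) => [ij|[p pi pj]].
  have iN : index i s < N.
    by apply: leq_trans ij _; rewrite -[N in _ <= N](size_tuple s) index_size.
  exists (Ordinal iN) => [|p' p'i].
    by rewrite (tnth_nth i) nth_index // -index_mem size_tuple.
  by apply/eqP => /nf; move: p'i => /=; lia.
apply: leq_ltn_trans (nf _ _ pi) _; rewrite ltnNge; apply/negP => jp.
have jN : index j s < N by apply: leq_ltn_trans jp (ltn_ord p).
have /eqP := pj (Ordinal jN) jp; apply.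
by rewrite (tnth_nth i) /= nth_index // -index_mem size_tuple.
Qed.

Lemma descent (N n : nat) (s : N.-tuple 'I_n) :
  inv_set s != set0 ->
  exists k k' : 'I_N, k' = k.+1 :> nat /\ tnth s k' < tnth s k.
Proof.
case/set0Pn => -[p p']; rewrite inE /= => /andP[pp' sp].
case: (boolP [exists k : 'I_N, exists k' : 'I_N,
    (k' == k.+1 :> nat) && (tnth s k' < tnth s k)]) => [|nodesc].
  by case/existsP => k /existsP[k' /andP[/eqP]]; exists k, k'.
suff le d (q q' : 'I_N) : q' = q + d :> nat -> tnth s q <= tnth s q'.
  have : tnth s p <= tnth s p' by apply: (le (p' - p)); lia.
  by rewrite leqNgt sp.
elim: d q' => [|d IH] q' q'E.
  by rewrite addn0 in q'E; rewrite (ord_inj q'E).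
have rN : q + d < N by have := ltn_ord q'; lia.
apply: leq_trans (IH (Ordinal rN) erefl) _; rewrite leqNgt.
apply: contra nodesc => sr.
apply/existsP; exists (Ordinal rN); apply/existsP; exists q'.
by rewrite sr andbT /=; apply/eqP; lia.
Qed.

Lemma in_BL_swap (n : nat) (m : 'I_n -> nat)
    (s : (\sum_(k < n) m k).-tuple 'I_n) (k k' : 'I_(\sum_(k < n) m k)) :
  k' = k.+1 :> nat -> tnth s k' < tnth s k -> in_BL m s ->
  in_BL m [tuple tnth s (tperm k k' p) | p < _].
Proof.
move=> kk' sk /andP[/forallP cnt /forallP fst].
apply/andP; split; apply/forallP => i.
  rewrite -(eqP (cnt i)); apply/eqP.
  have cE (u : (\sum_(k < n) m k).-tuple 'I_n) :
      count_mem i u = #|[set p | tnth u p == i]|.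
    rewrite -[in LHS](map_tnth_enum u) count_map cardsE cardE size_filter.
    by rewrite -enumT; apply: eq_count.
  rewrite !cE -[RHS](card_preimset _ (@perm_inj _ (tperm k k'))).
  by apply: eq_card => p; rewrite !inE tnth_mktuple.
apply/forallP => j; apply/implyP => ij.
have /index_ltP[p pi pj] := implyP (forallP (fst i) j) ij.
apply/index_ltP; exists (tperm k k' p); first by rewrite tnth_mktuple tpermK.
move=> q; rewrite tnth_mktuple => qp.
have [/pj //|pq] := leqP (tperm k k' q) p.
have [pk qk] : p = k /\ q = k.
  have ne (a b : 'I_(\sum_(k < n) m k)) : a <> b -> a <> b :> nat.
    by move=> ab /ord_inj.
  move: pq qp; case: tpermP => [->|->|/ne qk /ne qk'];
    case: tpermP => [->|->|/ne pk /ne pk'] pq qp;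
    by split; apply: ord_inj; lia.
rewrite qk tpermL; apply/eqP => skj.
by move: sk; rewrite skj -pk pi (eqP ij); lia.
Qed.

Lemma step_BL_pred (n : nat) (m : 'I_n -> nat) (s : BL m) :
  inversions s != 0 -> exists t, step_BL t s.
Proof.
rewrite /inversions cards_eq0 => /descent[k [k' [kk' sk]]].
exists (MkBL (in_BL_swap kk' sk (wordP s))).
apply/existsP; exists k; apply/existsP; exists k'.
rewrite kk' eqxx /= !tnth_mktuple tpermL tpermR sk /=.
by apply/eqP/eq_from_tnth => p; rewrite !tnth_mktuple tpermK.
Qed.

Lemma inversions_minimal (n : nat) (m : 'I_n -> nat) (s : BL m) :
  (forall t : BL m, ~~ (t < s)%O) -> inversions s = 0.
Proof.
move=> smin; apply/eqP/negPn/negP => /step_BL_pred[t ts].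
by have := smin t; rewrite (step_lt (@step_BL_inversions n m) (@le_BL n m) ts).
Qed.

Lemma inversions_cover (n : nat) (m : 'I_n -> nat) (s t : BL m) :
  covers s t -> inversions t = (inversions s).+1.
Proof.
move=> /(covers_step (@step_BL_inversions n m) (@le_BL n m)).
exact: step_BL_inversions.
Qed.

HB.instance Definition _ (n : nat) (m : 'I_n -> nat) :=
  FinPOrder_isGraded.Build BL_display (BL m)
    (@inversions_minimal n m) (@inversions_cover n m).

(* Main.v *)
(* In a word of BL(m) the smallest letter comes first, and its other m_1 - 1
   copies may be placed anywhere; deleting all copies leaves an arbitrary word
   of BL(m_2, ..., m_n), and the inversions lost are counted by a Gaussian
   binomial coefficient.  On the side of V(m) the blocks x_{i_1}, x_{i_2}, ...
   are independent of each other, and each is a zero followed by a weakly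
   increasing sequence with bounded entries, again counted by a Gaussian
   binomial coefficient.  Both counts follow from the q-Pascal recurrence. *)

Require Import Defs.
From mathcomp Require Import all_boot all_order all_algebra fraction.
From mathcomp Require Import zify ring.

Set Implicit Arguments.
Unset Strict Implicit.
Unset Printing Implicit Defensive.

Import GRing.Theory.

(** * Gaussian binomial coefficients *)

Definition list_gf (T : Type) (r : T -> nat) (l : seq T) : {poly int} :=
  (\sum_(x <- l) 'X^(r x))%R.

(* The polynomial [gauss a b] is the q-binomial coefficient [a + b choose a]. *)
Fixpoint gauss (a : nat) : nat -> {poly int} :=
  match a with
  | 0 => fun _ => 1%R
  | a'.+1 => fix gauss_S b := match b with
    | 0 => 1%R
    | b'.+1 => (gauss a' b + 'X^a * gauss_S b')%R
    end
  end.

Lemma gaussn0 a : gauss a 0 = 1%R. Proof. by case: a. Qed.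

Arguments gauss : simpl never.

Lemma gaussSS a b :
  gauss a.+1 b.+1 = (gauss a b.+1 + 'X^(a.+1) * gauss a.+1 b)%R.
Proof. by []. Qed.

Lemma qintD a b : qint (a + b) = (qint a + 'X^a * qint b)%R.
Proof.
rewrite /qint !big_mkord big_split_ord /= mulr_sumr; congr (_ + _)%R.
by apply: eq_bigr => i _; rewrite exprD.
Qed.

Lemma qfactS a : qfact a.+1 = (qfact a * qint a.+1)%R.
Proof. by rewrite /qfact big_nat_recr. Qed.

Lemma qfact0 : qfact 0 = 1%R. Proof. by rewrite /qfact big_nil. Qed.

(** Double induction: by [qintD] the top factor [a+b+2] is [a+1] + q^(a+1) [b+1], and these two
    summands match the two terms of the q-Pascal recurrence. *)
Lemma gauss_qfact a b : (gauss a b * (qfact b * qfact a) = qfact (a + b))%R.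
Proof.
elim: a b => [|a IHa] b; first by rewrite qfact0 mul1r mulr1.
elim: b => [|b IHb]; first by rewrite gaussn0 qfact0 !mul1r addn0.
have -> : qfact (a.+1 + b.+1) = (qfact (a + b).+1 * qint (a.+1 + b.+1))%R.
  by rewrite addSn addnS qfactS.
have := IHa b.+1; rewrite addnS => Ha.
have := IHb; rewrite addSn => Hb.
rewrite qintD mulrDr -{1}Ha -Hb gaussSS !qfactS; ring.
Qed.

(** At q = 0 each factor [qint k] with k > 0 takes the value 1. *)
Lemma qfact_neq0 a : (qfact a != 0)%R.
Proof.
rewrite /qfact prodf_seq_neq0; apply/allP => k.
rewrite mem_index_iota => /andP[k0 _].
apply/implyP => _; apply/eqP => /(congr1 (fun p : {poly int} => p.[0]%R)).
rewrite horner0 /qint horner_sum; case: k k0 => // k _.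
rewrite big_nat_recl // hornerXn expr0 big1 ?addr0; first by [].
by move=> i _; rewrite hornerXn expr0n.
Qed.

Lemma gauss_qbinom a b : tofrac (gauss a b) = qbinom (a + b) a.
Proof.
rewrite /qbinom addKn -gauss_qfact -tofracM.
rewrite [tofrac (gauss _ _ * _)%R]tofracM mulfK //.
by rewrite tofrac_eq0 mulf_neq0 ?qfact_neq0.
Qed.

(** * Inversions of words with inserted zeros *)

Fixpoint inv_seq (s : seq nat) : nat :=
  if s is x :: s' then count (fun y => y < x) s' + inv_seq s' else 0.

(* Words obtained from [w] by inserting [k] zeros. *)
Fixpoint insert0 (k : nat) : seq nat -> seq (seq nat) :=
  match k with
  | 0 => fun w => [:: w]
  | k'.+1 => fix insert0_S w := match w with
    | [::] => [:: nseq k 0]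
    | x :: w' => map (cons 0) (insert0 k' w) ++ map (cons x) (insert0_S w')
    end
  end.

Arguments insert0 : simpl never.

Lemma insert0_cons k x w :
  insert0 k.+1 (x :: w) =
  map (cons 0) (insert0 k (x :: w)) ++ map (cons x) (insert0 k.+1 w).
Proof. by []. Qed.

Lemma filter_nseq0 k : [seq x <- nseq k 0 | x != 0] = [::].
Proof. by elim: k. Qed.

Lemma count0_nz s : all (fun x => x != 0) s -> count_mem 0 s = 0.
Proof. by elim: s => //= x s IH /andP[/negbTE -> /IH]. Qed.

(** Since [w] contains no zero, erasing the zeros of a result gives back [w]; conversely, the number
    of zeros is the only other constraint. *)
Lemma mem_insert0 k w s : all (fun x => x != 0) w ->
  (s \in insert0 k w) =
  (count_mem 0 s == k) && ([seq x <- s | x != 0] == w).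
Proof.
elim: k w s => [|k IHk] w s.
  move=> nzw; rewrite inE; apply/eqP/andP => [->|[c0 /eqP <-]].
    by rewrite count0_nz // (all_filterP nzw).
  apply/esym/all_filterP/allP => x xs; apply/eqP => x0.
  by move: c0 => /eqP/count_memPn; rewrite -x0 xs.
elim: w s => [|x w IHw] s.
  move=> _; rewrite inE -/(nseq k.+1 0).
  apply/eqP/andP => [->|[/eqP c0 /eqP f0]].
    by rewrite count_nseq mul1n eqxx filter_nseq0.
  have s0 : all (pred1 0) s.
    rewrite -[all _ _]negbK -has_predC has_filter.
    by rewrite (@eq_filter _ _ (fun x => x != 0)) ?f0 //; move=> x.
  by move/all_pred1P: s0 c0 => ->; rewrite count_nseq mul1n => ->.
move=> /= /andP[nzx nzw]; rewrite insert0_cons mem_cat.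
case: s => [|y s] /=.
  by apply/norP; split; apply/mapP => -[].
have consE (z : nat) (l : seq (seq nat)) :
    (y :: s \in map (cons z) l) = (y == z) && (s \in l).
  apply/mapP/andP => [[t tl [-> ->]]|[/eqP -> sl]]; first by rewrite eqxx.
  by exists s.
rewrite !consE IHk ?IHw //=; last by rewrite nzx nzw.
have [->|y0] := eqVneq y 0 => /=.
  by rewrite (eq_sym 0) (negbTE nzx) /= orbF add1n eqSS.
by rewrite add0n andbCA.
Qed.

(** The two branches of the recursion are disjoint: one yields words with head 0, the other words
    with the nonzero head of [w]. *)
Lemma uniq_insert0 k w : all (fun x => x != 0) w -> uniq (insert0 k w).
Proof.
elim: k w => [//|k IHk]; elim=> [//|x w IHw] /= /andP[nzx nzw].
have consI (z : nat) : injective (cons z) by move=> ? ? [].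
rewrite insert0_cons cat_uniq !map_inj_uniq // IHk /= ?nzx // IHw // andbT.
apply/hasPn => s /mapP[t _ ->]; apply/mapP => -[u _ [x0]].
by rewrite x0 in nzx.
Qed.

Lemma perm_insert0 k w s : all (fun x => x != 0) w ->
  s \in insert0 k w -> perm_eq s (nseq k 0 ++ w).
Proof.
move=> nzw; rewrite mem_insert0 // => /andP[/eqP c0 /eqP <-].
rewrite -(perm_filterC (pred1 0) s).
apply: perm_cat; last by [].
by have /all_pred1P -> := filter_all (pred1 0) s; rewrite size_filter c0.
Qed.

Lemma list_gf_cons_lt x c (l : seq (seq nat)) :
  {in l, forall s, count (fun y => y < x) s = c} ->
  list_gf inv_seq (map (cons x) l) = ('X^c * list_gf inv_seq l)%R.
Proof.
move=> lc; rewrite /list_gf big_map mulr_sumr big_seq [RHS]big_seq.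
by apply: eq_bigr => s /lc /= ->; rewrite exprD.
Qed.

(** The branches of [insert0] run parallel to the terms of the recurrence of [gauss]; a leading zero
    creates no inversion. *)
Lemma list_gf_insert0 k w : all (fun x => x != 0) w ->
  list_gf inv_seq (insert0 k w) = ('X^(inv_seq w) * gauss k (size w))%R.
Proof.
elim: k w => [|k IHk] w nzw; first by rewrite /list_gf big_seq1 mulr1.
elim: w nzw => [_|x w IHw /= /andP[nzx nzw]].
  rewrite /list_gf big_seq1 gaussn0 mulr1 /=; congr ('X^_)%R.
  by elim: k {IHk} => //= k ->; rewrite count_nseq.
rewrite insert0_cons /list_gf big_cat /= -!/(list_gf _ _).
rewrite (@list_gf_cons_lt 0 0); last first.
  by move=> s _; rewrite (@eq_count _ _ pred0) ?count_pred0.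
(* The head [x] is inverted with all k+1 zeros behind it, besides its inversions within [x :: w];
   this is the factor q^(k+1) of the recurrence. *)
rewrite (@list_gf_cons_lt x (k.+1 + count (fun y => y < x) w)); last first.
  move=> s sw; rewrite (seq.permP (perm_insert0 nzw sw)).
  by rewrite count_cat count_nseq lt0n nzx mul1n.
rewrite IHk /= ?nzx // IHw // gaussSS !exprD expr0; ring.
Qed.

(** * Recursive enumeration of the words of BL *)

(** The shift by [S] frees the letter 0. One zero is forced to the front, which leaves [k.-1] zeros
    to insert. *)
Fixpoint BL_words (ms : seq nat) : seq (seq nat) :=
  if ms is k :: ms' then
    [seq 0 :: v | w <- BL_words ms', v <- insert0 k.-1 (map S w)]
  else [:: [::]].

(** Because [nth] defaults to 0, the first clause also forbids every letter not below [size ms]. *)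
Definition BL_word (ms s : seq nat) : Prop :=
  (forall i, count_mem i s = nth 0 ms i) /\
  (forall i, i.+1 < size ms -> index i s < index i.+1 s).

Lemma map_succ_nz w : all (fun x => x != 0) (map S w).
Proof. by elim: w. Qed.

Lemma map_succ_predK s : all (fun x => x != 0) s -> map S (map predn s) = s.
Proof. by elim: s => //= -[|x] s IH //= /IH ->. Qed.

Lemma inv_seq_map_succ w : inv_seq (map S w) = inv_seq w.
Proof. by elim: w => //= x w ->; rewrite count_map. Qed.

Lemma count_filter_nz i s :
  count_mem i.+1 [seq x <- s | x != 0] = count_mem i.+1 s.
Proof.
by rewrite count_filter; apply: eq_count => x /=; case: eqP => // ->.
Qed.

Lemma count_map_succ i w : count_mem i.+1 (map S w) = count_mem i w.
Proof. by rewrite count_map; apply: eq_count => x /=; rewrite eqSS. Qed.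

Lemma index_map_succ i w : index i.+1 (map S w) = index i w.
Proof. by rewrite index_map //; apply: succn_inj. Qed.

(** The erased elements are neither [x] nor [y], so their removal shifts positions without changing
    which of the two comes first. *)
Lemma ltn_index_filter (T : eqType) (a : pred T) (x y : T) (s : seq T) :
  a x -> a y ->
  (index x (filter a s) < index y (filter a s)) = (index x s < index y s).
Proof.
move=> ax ay; elim: s => //= z s IH.
have [az|naz] := boolP (a z) => /=.
  by case: (z == x); case: (z == y); rewrite ?ltnS.
have zx : z != x by apply: contraNneq naz => ->.
have zy : z != y by apply: contraNneq naz => ->.
by rewrite (negbTE zx) (negbTE zy) ltnS.
Qed.

Lemma BL_word_cons k ms s : 0 < k ->
  BL_word (k :: ms) s <->
  exists2 w, BL_word ms w &
    exists v, [/\ s = 0 :: v, count_mem 0 v = k.-1 &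
      [seq x <- v | x != 0] = map S w].
Proof.
case: k => // k _; split=> [[cnt fst]|[w [cnt fst] [v [-> c0 fv]]]]; last first.
  split=> [[|i]|[|i]] /=.
  - by rewrite c0.
  - by rewrite add0n -count_filter_nz fv count_map_succ cnt.
  - by [].
  - rewrite !ltnS => im; rewrite -(@ltn_index_filter _ (fun x => x != 0)) //.
    by rewrite fv !index_map_succ fst.
case: s cnt fst => [|y v] cnt fst; first by have := cnt 0.
(* Were the first letter [y.+1], the letter [y] would have to occur before position 0. *)
have y0 : y = 0.
  case: y cnt fst => // y cnt fst.
  have yms : y < size ms.
    rewrite ltnNge; apply/negP => /(nth_default 0) ym.
    by have := cnt y.+1; rewrite /= ym eqxx.
  by have := fst y yms; rewrite /= eqxx.
subst y; pose w := map predn [seq x <- v | x != 0].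
have fv : [seq x <- v | x != 0] = map S w by rewrite map_succ_predK ?filter_all.
exists w; last by exists v; split=> //; have := cnt 0; rewrite /= => -[].
split=> i.
  by rewrite -count_map_succ -fv count_filter_nz; have := cnt i.+1.
move=> im; rewrite -(index_map_succ i w) -(index_map_succ i.+1 w) -fv.
by rewrite (@ltn_index_filter _ (fun x => x != 0)) //; have := fst i.+1 im.
Qed.

Lemma mem_BL_words ms s : all (fun k => 0 < k) ms ->
  s \in BL_words ms <-> BL_word ms s.
Proof.
elim: ms s => [|k ms IH] s /=.
  move=> _; rewrite inE; split=> [/eqP ->|[cnt _]]; first by split=> // -[].
  case: s cnt => // x s cnt.
  by have := cnt x; rewrite /= eqxx nth_nil.
move=> /andP[k0 ms0]; rewrite BL_word_cons //; split.
  case/allpairsPdep => w [v [/(IH _ ms0) wP]].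
  rewrite mem_insert0 ?map_succ_nz // => /andP[/eqP c0 /eqP fv] ->.
  by exists w => //; exists v.
case=> w /(IH _ ms0) wP [v [-> c0 fv]].
apply/allpairsPdep; exists w, v; split=> //.
by rewrite mem_insert0 ?map_succ_nz // c0 fv !eqxx.
Qed.

(** A word [0 :: v] determines both choices behind it: erasing the zeros of [v] leaves [map S w],
    and [S] is injective. *)
Lemma uniq_BL_words ms : uniq (BL_words ms).
Proof.
elim: ms => //= k ms IH; apply: allpairs_uniq_dep => //.
  by move=> w _; rewrite uniq_insert0 ?map_succ_nz.
move=> [w v] [w' v'] /= /allpairsPdep[w1 [v1 [_ v1P [E1 E2]]]].
move=> /allpairsPdep[w2 [v2 [_ v2P [E1' E2']]]] [vE]; subst.
move: v1P v2P; rewrite !mem_insert0 ?map_succ_nz //.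
move=> /andP[_ /eqP ->] /andP[_ /eqP /(inj_map succn_inj) ->].
by [].
Qed.

Lemma size_mem_BL_words ms s : all (fun k => 0 < k) ms ->
  s \in BL_words ms -> size s = sumn ms.
Proof.
elim: ms s => [|k ms IH] s /=; first by move=> _; rewrite inE => /eqP ->.
move=> /andP[k0 ms0] /allpairsPdep[w [v [/(IH _ ms0) wE]]].
rewrite mem_insert0 ?map_succ_nz // => /andP[/eqP c0 /eqP fv] -> /=.
rewrite -(count_predC (pred1 0) v) c0 -size_filter.
rewrite (eq_filter (a2 := fun x => x != 0)) // fv size_map wE; lia.
Qed.

(** The leading zero adds no inversion, and inserting the others contributes a factor that depends
    on [w] only through its length, which is [sumn ms] for every [w]. *)
Lemma list_gf_BL_words k ms : 0 < k -> all (fun k => 0 < k) ms ->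
  list_gf inv_seq (BL_words (k :: ms)) =
  (gauss k.-1 (sumn ms) * list_gf inv_seq (BL_words ms))%R.
Proof.
move=> k0 ms0; rewrite /list_gf big_allpairs_dep /= mulr_sumr.
rewrite big_seq [RHS]big_seq; apply: eq_bigr => w wms.
under eq_bigr => v _ do
  rewrite [count _ _](@eq_count _ _ pred0) ?count_pred0 //.
rewrite -/(list_gf _ _) list_gf_insert0 ?map_succ_nz //.
by rewrite inv_seq_map_succ size_map (size_mem_BL_words ms0 wms) mulrC.
Qed.

Lemma list_gf_BL_words_codom (n : nat) (m : 'I_n -> nat) :
  (forall i, 0 < m i) ->
  list_gf inv_seq (BL_words (codom m)) =
  (\prod_(i < n) gauss (m i).-1 (\sum_(k < n | i < k) m k)%N)%R.
Proof.
elim: n m => [|n IH] m m0.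
  have -> : codom m = [::] by apply: size0nil; rewrite size_codom card_ord.
  by rewrite big_ord0 /list_gf big_seq1.
have -> : codom m = m ord0 :: codom (m \o lift ord0).
  by rewrite /codom /image_mem enum_ordSl /= -map_comp.
rewrite list_gf_BL_words //; last by apply/allP => k /codomP[i ->]; apply: m0.
rewrite IH; last by move=> i; apply: m0.
rewrite big_ord_recl; congr (gauss _ _ * _)%R.
  by rewrite sumnE big_image [RHS]big_mkcond big_ord_recl /= add0n.
apply: eq_bigr => i _; congr gauss.
by rewrite [RHS]big_mkcond big_ord_recl /= add0n -big_mkcond.
Qed.

(** * From lists of numbers to the tuples of [BL m] *)

(** The set is counted as a double sum of indicators over pairs of positions. Row 0 gives the count
    for the head, and column 0 vanishes since no position precedes the first. *)
Lemma inv_seq_card (N n : nat) (s : N.-tuple 'I_n) :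
  #|inv_set s| = inv_seq (map val s).
Proof.
have -> : #|inv_set s| =
    \sum_(p < N) \sum_(p' < N) ((p < p') && (tnth s p' < tnth s p)).
  rewrite pair_bigA /= -sum1_card big_mkcond /=.
  by apply: eq_bigr => p _; rewrite inE; case: (_ && _).
elim: N s => [|N IH] s; first by rewrite tuple0 big_ord0.
case/tupleP: s => x s; rewrite big_ord_recl big_ord_recl /= add0n.
congr (_ + _).
  rewrite count_map -sum1_count big_tuple [RHS]big_mkcond /=.
  by apply: eq_bigr => p _; rewrite tnthS tnth0; case: (_ < _).
rewrite -IH; apply: eq_bigr => p _; rewrite big_ord_recl /= add0n.
by apply: eq_bigr => p' _; rewrite !tnthS.
Qed.

Lemma BL_word_in_BL (n : nat) (m : 'I_n -> nat)
    (s : (\sum_(k < n) m k).-tuple 'I_n) :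
  in_BL m s <-> BL_word (codom m) (map val s).
Proof.
have szm : size (codom m) = n by rewrite size_codom card_ord.
have nthm (i : 'I_n) : nth 0 (codom m) i = m i.
  by rewrite /codom /image_mem (nth_map i) ?size_enum_ord ?nth_ord_enum.
have idx (i : 'I_n) : index (val i) (map val s) = index i s.
  by rewrite index_map //; apply: val_inj.
have cnt_val (i : 'I_n) : count_mem (val i) (map val s) = count_mem i s.
  by rewrite count_map; apply: eq_count => x /=; rewrite val_eqE.
split=> [/andP[/forallP cnt /forallP fst]|[cnt fst]].
  split=> i; last first.
    rewrite szm => ilt; have ilt' := ltnW ilt.
    rewrite (idx (Ordinal ilt')) (idx (Ordinal ilt)).
    by have /forallP/(_ (Ordinal ilt))/implyP -> := fst (Ordinal ilt').
  (* [BL_word] also speaks of letters [i] not below [n]; there both counts are 0. *)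
  have [ilt|ige] := ltnP i n.
    by rewrite (cnt_val (Ordinal ilt)) (nthm (Ordinal ilt)) (eqP (cnt _)).
  rewrite nth_default ?szm //; apply/count_memPn/mapP => -[x _ ix].
  by have := ltn_ord x; rewrite ix /= in ige; lia.
apply/andP; split; apply/forallP => i.
  by rewrite -nthm -cnt -cnt_val.
apply/forallP => j; apply/implyP => /eqP ij.
by rewrite -!idx /= ij fst // szm -ij.
Qed.

Lemma sumn_codom (n : nat) (m : 'I_n -> nat) :
  sumn (codom m) = \sum_(k < n) m k.
Proof. by rewrite sumnE big_image. Qed.

Lemma perm_BL_words (n : nat) (m : 'I_n -> nat) : (forall i, 0 < m i) ->
  perm_eq [seq map val (word b) | b <- enum {: BL m}] (BL_words (codom m)).
Proof.
move=> m0; have ms0 : all (fun k => 0 < k) (codom m).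
  by apply/allP => k /codomP[i ->].
apply: uniq_perm (uniq_BL_words _) _ => [|s].
  rewrite map_inj_uniq ?enum_uniq // => b c /(inj_map val_inj) bc.
  by apply/val_inj/val_inj.
apply/idP/idP => [/mapP[b _ ->]|sP].
  by apply/mem_BL_words/BL_word_in_BL; first by []; apply: (wordP b).
have sz := size_mem_BL_words ms0 sP; rewrite sumn_codom in sz.
move: sP => /(mem_BL_words _ ms0) sP.
(* No letter is lost by [insub]: a letter not below [n] would have the default count 0 and so could
   not occur in [s]. *)
have sK : map val (pmap (insub : nat -> option 'I_n) s) = s.
  rewrite pmap_filter; last exact: insubK.
  apply/all_filterP/allP => x xs; rewrite isSome_insub.
  rewrite ltnNge; apply/negP => xn.
  have [cnt _] := sP; have := cnt x.
  rewrite nth_default ?size_codom ?card_ord // => /count_memPn.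
  by rewrite xs.
have tsz : size (pmap (insub : nat -> option 'I_n) s) == \sum_(k < n) m k.
  by rewrite -(size_map val) sK sz.
have tP : in_BL m (Tuple tsz) by apply/BL_word_in_BL; rewrite /= sK.
by apply/mapP; exists (MkBL tP); rewrite ?mem_enum //= sK.
Qed.

Lemma rank_gf_BL (n : nat) (m : 'I_n -> nat) : (forall i, 0 < m i) ->
  rank_gf (BL m) =
  (\prod_(i < n) gauss (m i).-1 (\sum_(k < n | i < k) m k)%N)%R.
Proof.
move=> m0; rewrite -list_gf_BL_words_codom // /list_gf.
rewrite -(perm_big _ (perm_BL_words m0)) big_map big_enum.
by apply: eq_bigr => b _; rewrite -inv_seq_card.
Qed.

(** * Bounded weakly increasing sequences *)

(* Weakly increasing sequences of length [k] with entries at most [b]. *)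
Fixpoint monotone_seqs (k : nat) : nat -> seq (seq nat) :=
  match k with
  | 0 => fun _ => [:: [::]]
  | k'.+1 => fix monotone_S b := match b with
    | 0 => [:: nseq k 0]
    | b'.+1 => map (cons 0) (monotone_seqs k' b) ++ map (map S) (monotone_S b')
    end
  end.

Arguments monotone_seqs : simpl never.

Lemma monotone_seqsSS k b :
  monotone_seqs k.+1 b.+1 =
  map (cons 0) (monotone_seqs k b.+1) ++ map (map S) (monotone_seqs k.+1 b).
Proof. by []. Qed.

Lemma mem_monotone_seqs k b s :
  (s \in monotone_seqs k b) =
  [&& size s == k, sorted leq s & all (fun x => x <= b) s].
Proof.
elim: k b s => [|k IHk] b s; first by rewrite inE; case: s.
elim: b s => [|b IHb] s.
  rewrite inE; apply/eqP/and3P => [->|[/eqP sz _ s0]].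
    rewrite size_nseq eqxx; split=> //; last by rewrite all_nseq orbT.
    by elim: k {IHk} => //= k; rewrite /= => ->.
  rewrite -sz; apply/all_pred1P; apply: sub_all s0 => x /=.
  by rewrite leqn0.
rewrite monotone_seqsSS mem_cat.
apply/orP/and3P => [[/mapP[t]|/mapP[t]]|].
- rewrite IHk => /and3P[/eqP <- st bt] ->; split=> //=.
  by rewrite path_min_sorted //; apply/allP.
- rewrite IHb => /and3P[/eqP <- st bt] ->; split; first by rewrite size_map.
  + by rewrite sorted_map.
  + by rewrite all_map.
case: s => [|x s] [] //= /eqP[sz] ps /andP[xb sb].
case: x ps xb => [|x] ps xb.
  left; apply/mapP; exists s => //.
  by rewrite IHk sz eqxx sb (path_sorted ps).
(* The head is positive and least, so all entries are positive and can be lowered by one. *)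
right; have sK : map S (map predn (x.+1 :: s)) = x.+1 :: s.
  apply: map_succ_predK; rewrite /=; apply/allP => y ys.
  by have /allP/(_ y ys) := order_path_min leq_trans ps; case: y {ys}.
apply/mapP; exists (map predn (x.+1 :: s)); last by rewrite sK.
rewrite IHb size_map /= sz eqxx /=; apply/andP; split.
  rewrite -[path _ _ _]/(sorted leq (map predn (x.+1 :: s))).
  have : sorted leq (x.+1 :: s) by [].
  by rewrite -[in X in X -> _]sK sorted_map.
rewrite -ltnS xb all_map; apply: sub_all sb => -[|y] //=.
Qed.

Lemma uniq_monotone_seqs k b : uniq (monotone_seqs k b).
Proof.
elim: k b => [//|k IHk]; elim=> [//|b IHb].
rewrite monotone_seqsSS cat_uniq !map_inj_uniq ?IHk ?IHb //.
- rewrite andbT /=; apply/hasPn => s /mapP[t _ ->].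
  by apply/mapP => -[u _]; case: t.
- by apply/inj_map/succn_inj.
- by move=> ? ? [].
Qed.

(** A sequence of length k+1 either starts with 0 or has only positive entries. Lowering these by
    one removes k+1 from the sum, which again is the q-Pascal recurrence. *)
Lemma list_gf_monotone k b : list_gf sumn (monotone_seqs k b) = gauss k b.
Proof.
elim: k b => [|k IHk] b; first by rewrite /list_gf big_seq1.
have szS c s : s \in monotone_seqs k.+1 c -> size s = k.+1.
  by rewrite mem_monotone_seqs => /and3P[/eqP].
elim: b => [|b IHb].
  by rewrite /list_gf big_seq1 sumn_nseq mul0n gaussn0.
rewrite monotone_seqsSS gaussSS /list_gf big_cat /= !big_map -!/(list_gf _ _).
rewrite -IHk -IHb /list_gf mulr_sumr; congr (_ + _)%R.
rewrite big_seq [RHS]big_seq; apply: eq_bigr => s /szS sz.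
rewrite -exprD -sz; congr ('X^_)%R.
by elim: s {sz} => //= x s ->; rewrite addSn addnCA addSn.
Qed.

(** * A single block of a vector of V *)

(** The conditions of [in_V] for one fixed [i]. The bound [b] is kept apart from [N] so that all
    blocks can share one codomain. *)
Definition block (k N b : nat) (f : {ffun 'I_k -> 'I_N.+1}) : bool :=
  [forall j : 'I_k, ((j == 0 :> nat) ==> (f j == 0 :> nat)) &&
     [forall j' : 'I_k, (j' == j.+1 :> nat) ==> (f j <= f j' <= b)]].

(** The entry at [ord0] of a block is forced to be 0, so the tail carries all the information. *)
Definition block_tail (k N : nat) (f : {ffun 'I_k.+1 -> 'I_N.+1}) : seq nat :=
  [seq val (f (lift ord0 j)) | j <- enum 'I_k].

Lemma nth_block_tail (k N : nat) (f : {ffun 'I_k.+1 -> 'I_N.+1}) (j : 'I_k) :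
  nth 0 (block_tail f) j = f (lift ord0 j).
Proof. by rewrite (nth_map j) ?size_enum_ord // nth_ord_enum. Qed.

Lemma perm_block_tail (k N b : nat) : b <= N ->
  perm_eq
    [seq block_tail f | f <- enum
       [pred f : {ffun 'I_k.+1 -> 'I_N.+1} | block b f]]
    (monotone_seqs k b).
Proof.
move=> bN; apply: uniq_perm (uniq_monotone_seqs _ _) _ => [|s].
  rewrite map_inj_in_uniq ?enum_uniq // => f g.
  rewrite !mem_enum !inE => /forallP fP /forallP gP fg.
  apply/ffunP => j; apply: val_inj; case: (unliftP ord0 j) => [j'|] ->.
    by have := congr1 (fun s => nth 0 s j') fg; rewrite !nth_block_tail.
  have /andP[/implyP/(_ isT)/eqP f0 _] := fP ord0.
  have /andP[/implyP/(_ isT)/eqP g0 _] := gP ord0.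
  exact: etrans f0 (esym g0).
have szt (f : {ffun 'I_k.+1 -> 'I_N.+1}) : size (block_tail f) = k.
  by rewrite size_map size_enum_ord.
rewrite mem_monotone_seqs; apply/mapP/and3P => [[f]|[/eqP sz ss sb]].
  rewrite mem_enum inE => /forallP fP -> {s}; rewrite szt; split=> //.
    apply/(sortedP 0) => i; rewrite szt => ik.
    rewrite (nth_block_tail f (Ordinal (ltnW ik))).
    rewrite (nth_block_tail f (Ordinal ik)).
    have /andP[_ /forallP/(_ (lift ord0 (Ordinal ik)))] :=
      fP (lift ord0 (Ordinal (ltnW ik))).
    by rewrite /= eqxx => /andP[].
  apply/(all_nthP 0) => i; rewrite szt => ik.
  rewrite (nth_block_tail f (Ordinal ik)).
  (* Tail position [i] is block position i+1, and [block] attaches the bound on an entry to its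
     predecessor, here block position [i]. *)
  have ik' : i < k.+1 by rewrite ltnS ltnW.
  have /andP[_ /forallP/(_ (lift ord0 (Ordinal ik)))] := fP (Ordinal ik').
  by rewrite /= eqxx => /andP[].
have nb i : nth 0 s i <= b.
  have [si|/(nth_default 0) -> //] := ltnP i (size s).
  by move/(all_nthP 0): sb => ->.
(* The preimage of [s] restores the forced zero in front; [inord] alters nothing because all entries
   are at most b <= N. *)
pose f : {ffun 'I_k.+1 -> 'I_N.+1} :=
  [ffun j => inord (nth 0 (0 :: s) (val j))].
have fE j : f j = nth 0 (0 :: s) j :> nat.
  rewrite ffunE inordK // ltnS; case: j => -[|i] //= _.
  exact: leq_trans (nb i) bN.
exists f; last first.
  apply: (@eq_from_nth _ 0) => [|i]; rewrite ?szt sz // => ik.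
  by rewrite (nth_block_tail f (Ordinal ik)) fE.
rewrite mem_enum inE; apply/forallP => j; rewrite fE; apply/andP; split.
  by apply/implyP => /eqP ->.
apply/forallP => j'; rewrite fE; apply/implyP => /eqP jj'; rewrite jj' /= nb.
rewrite andbT; case: j jj' => -[|i] //= ik jj'.
by move/(sortedP 0): ss; apply; rewrite sz -ltnS -jj'.
Qed.

Lemma block_gf (k N b : nat) : 0 < k -> b <= N ->
  (\sum_(f : {ffun 'I_k -> 'I_N.+1} | block b f) 'X^(\sum_(j < k) f j)%N)%R =
  gauss k.-1 b.
Proof.
case: k => // k _ bN; rewrite -list_gf_monotone /list_gf.
rewrite -(perm_big _ (perm_block_tail _ bN)) big_map big_enum.
apply: eq_bigr => f /forallP/(_ ord0)/andP[/implyP/(_ isT)/eqP f0 _].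
by rewrite big_ord_recl f0 sumnE big_map big_enum.
Qed.

Lemma in_V_block (n : nat) (m : 'I_n -> nat)
    (x : {ffun {i : 'I_n & 'I_(m i)} -> 'I_(\sum_(k < n) m k).+1}) :
  in_V m x =
  [forall i : 'I_n, block (\sum_(k < n | i < k) m k)
     [ffun j : 'I_(m i) => x (slot j)]].
Proof.
apply: eq_forallb => i; apply: eq_forallb => j; rewrite ffunE; congr andb.
by apply: eq_forallb => j'; rewrite ffunE.
Qed.

(** * From independent blocks to a product *)

(** Distributivity when the summation type varies with the factor. The predicates are first absorbed
    into terms [G] that vanish outside them. *)
Lemma prod_sum_fprod (R : comPzSemiRingType) (I : finType) (T_ : I -> finType)
    (P : forall i, pred (T_ i)) (F : forall i, T_ i -> R) :
  (\prod_i \sum_(y : T_ i | P i y) F i y =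
   \sum_(t : fprod T_ | [forall i, P i (t i)]) \prod_i F i (t i))%R.
Proof.
pose G i : {ffun T_ i -> R} := [ffun y => if P i y then F i y else 0%R].
transitivity (\sum_(t : fprod T_) \prod_i G i (t i))%R.
  rewrite (@big_fprod _ 0%R 1%R _ _ _ _ G).
  (* All the [T_ i] are gathered in one tagged type, where the distributive law for a fixed codomain
     applies. *)
  transitivity (\prod_i \sum_(y in tagged_with T_ i) untag 0 (G i) y)%R;
    last exact: bigA_distr_big_dep.
  apply: eq_bigr => i _; rewrite big_mkcond.
  rewrite -[RHS](big_tag (fun i (y : T_ i) => G i y)).
  by apply: eq_bigr => y _; rewrite ffunE.
rewrite [RHS]big_mkcond; apply: eq_bigr => t _.
have [/forallP Pt|/forallPn[i nP]] := ifPn.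
  by apply: eq_bigr => i _; rewrite ffunE Pt.
by rewrite (bigD1 i) //= ffunE (negbTE nP) mul0r.
Qed.

Lemma rank_gf_V (n : nat) (m : 'I_n -> nat) : (forall i, 0 < m i) ->
  rank_gf (V m) =
  (\prod_(i < n) gauss (m i).-1 (\sum_(k < n | i < k) m k)%N)%R.
Proof.
move=> m0; pose N := \sum_(k < n) m k.
have leN i : \sum_(k < n | i < k) m k <= N.
  by rewrite big_mkcond leq_sum // => k _; case: ifP.
under eq_bigr => i _ do rewrite -(block_gf (m0 i) (leN i)).
pose T_ i := {ffun 'I_(m i) -> 'I_N.+1}.
rewrite (@prod_sum_fprod _ _ T_).
transitivity (\sum_(x | in_V m x) 'X^(\sum_p x p)%N : {poly int})%R.
  rewrite [RHS](reindex_omap (@entries n m) insub) => [|x xV]; last first.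
    by rewrite insubT.
  rewrite /rank_gf; apply: eq_bigl => v.
  by rewrite valK eqxx andbT; apply/esym; exact: entriesP.
(* Currying: a vector over all slots is the same as a family of blocks, one for each [i], and its
   entry sum splits accordingly. *)
pose h (t : fprod T_) : {ffun {i : 'I_n & 'I_(m i)} -> 'I_N.+1} :=
  [ffun p => t (tag p) (tagged p)].
pose h' (x : {ffun {i : 'I_n & 'I_(m i)} -> 'I_N.+1}) : fprod T_ :=
  [fprod i => [ffun j : 'I_(m i) => x (slot j)]].
rewrite (reindex h); last first.
  apply: onW_bij; exists h' => [t|x].
    by apply/fprodP => i; rewrite fprodE; apply/ffunP => j; rewrite !ffunE.
  by apply/ffunP => -[i j]; rewrite ffunE fprodE ffunE.
apply: eq_big => t.
  rewrite in_V_block; apply: eq_forallb => i; congr block.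
  by apply/ffunP => j; rewrite !ffunE.
move=> _; rewrite prodrXr; congr ('X^_)%R.
under eq_bigr => p _ do rewrite ffunE.
by rewrite (sig_big_dep _ (fun i j => true) (fun i j => t i j : nat)).
Qed.

(** * The product in terms of q-binomials *)

Lemma prod_gauss_qbinom (n : nat) (m : 'I_n -> nat) : (forall i, 0 < m i) ->
  (tofrac (\prod_(i < n) gauss (m i).-1 (\sum_(k < n | i < k) m k)%N) =
   \prod_(i < n) qbinom (\sum_(j < n | i <= j) m j - 1)%N (m i - 1)%N)%R.
Proof.
move=> m0; rewrite rmorph_prod; apply: eq_bigr => i _.
apply: etrans (gauss_qbinom _ _) _.
rewrite [\sum_(j < n | i <= j) _](bigD1 i) //= !subn1; congr qbinom.
have -> : \sum_(j < n | (i <= j) && (j != i)) m j = \sum_(k < n | i < k) m k.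
  by apply: eq_bigl => j; rewrite ltn_neqAle andbC eq_sym.
(* With S the sum of the later m_k, positivity of m_i gives (m_i - 1) + S = (m_i + S) - 1 despite
   truncated subtraction. *)
by have := m0 i; case: (m i).
Qed.

Theorem theorem4p1 (n : nat) (m : 'I_n -> nat)
    (m_gt0 : forall i : 'I_n, (0 < m i)%N) :
  tofrac (rank_gf (V m)) =
    (\prod_(i < n) qbinom (\sum_(j < n | i <= j) m j - 1)%N (m i - 1)%N)%R /\
  tofrac (rank_gf (BL m)) =
    (\prod_(i < n) qbinom (\sum_(j < n | i <= j) m j - 1)%N (m i - 1)%N)%R.
Proof. by rewrite rank_gf_V // rank_gf_BL // prod_gauss_qbinom. Qed.
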